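(* Let four mutually tangent circles in the plane form a Descartes configuration, given a compatible orientation, with oriented curvatures $b_1,b_2,b_3,b_4$ and centers $(x_j,y_j)$, written as complex numbers $z_j = x_j + i y_j$. Then $$\sum_{j=1}^4 (b_j z_j)^2 = \frac{1}{2}\Big(\sum_{j=1}^4 b_j z_j\Big)^2 .$$
   Context: A Descartes configuration is a set of four mutually tangent circles in the plane $\mathbb{R}^2\cong\mathbb{C}$ in which no three circles have a common tangent (i.e. the pairs of tangent circles have distinct points of tangency). Straight lines are allowed as degenerate circles; two parallel lines are regarded as tangent at infinity. An oriented circle is a circle with an assigned direction of unit normal vector, pointing inward or outward. If the circle has radius $r>0$, its oriented curvature is $1/r$ for an inward pointing normal and $-1/r$ for an outward pointing normal. The interior of an oriented circle is its usual interior for an inward pointing normal, and its usual exterior for an outward pointing normal. A straight line is oriented by a unit normal vector $h=(h_1,h_2)$; it has oriented curvature $0$ and its interior is the open half-plane into which $h$ points. The orientation of a Descartes configuration is compatible if either the interiors of all four oriented circles are disjoint, or the interiors are disjoint when all orientations are reversed. Each Descartes configuration has exactly two compatible orientations, each obtained from the other by reversing all orientations. For a straight line in the configuration with oriented unit normal $(h_1,h_2)$, the product $b_j z_j$ is interpreted as $h_1 + i h_2$. *)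

(* Defs.v *)
From mathcomp Require Import all_boot all_order all_algebra.
From mathcomp Require Import complex.
From mathcomp Require Import all_classical all_reals.
From mathcomp Require Import interval_inference.

Set Implicit Arguments.
Unset Strict Implicit.
Unset Printing Implicit Defensive.

Import Order.TTheory GRing.Theory Num.Theory.

Local Open Scope classical_set_scope.
Local Open Scope complex_scope.
Local Open Scope ring_scope.

(* The plane R^2 is identified with R[i].  [OCircle inward z r] is the circle
   of center z and radius r > 0, with unit normal pointing inward iff [inward].
   [OLine h p _] is the line {w | <h, w> = p} oriented by the unit normal h. *)
Inductive ocircle (R : realType) : Type :=
| OCircle (inward : bool) (z : R[i]) (r : {posnum R})
| OLine (h : R[i]) (p : R) (h1 : `|h| = 1).
Arguments OLine [R] h p h1.

Definition dotc (R : realType) (h w : R[i]) : R :=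
  complex.Re h * complex.Re w + complex.Im h * complex.Im w.

(* The underlying unoriented curve in the extended plane, where [None] is the
   point at infinity, which lies on every line and on no circle. *)
Definition locus (R : realType) (C : ocircle R) : set (option R[i]) :=
  match C with
  | OCircle _ z r => Some @` [set w : R[i] | `|w - z| = (r%:num)%:C]
  | OLine h p _ => None |` (Some @` [set w : R[i] | dotc h w = p])
  end.

Definition ointerior (R : realType) (C : ocircle R) : set R[i] :=
  match C with
  | OCircle true z r => [set w : R[i] | `|w - z| < (r%:num)%:C]
  | OCircle false z r => [set w : R[i] | (r%:num)%:C < `|w - z|]
  | OLine h p _ => [set w : R[i] | p < dotc h w]
  end.

Definition oreverse (R : realType) (C : ocircle R) : ocircle R :=
  match C with
  | OCircle inward z r => OCircle (~~ inward) z r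
  | OLine h p h1 => OLine (- h) (- p) (etrans (normrN h) h1)
  end.

Definition ocurvature (R : realType) (C : ocircle R) : R :=
  match C with
  | OCircle true _ r => (r%:num)^-1
  | OCircle false _ r => - (r%:num)^-1
  | OLine _ _ _ => 0
  end.

(* The product b z, with its conventional value h_1 + i h_2 for a line. *)
Definition curvature_center (R : realType) (C : ocircle R) : R[i] :=
  match C with
  | OCircle _ z _ => (ocurvature C)%:C * z
  | OLine h _ _ => h
  end.

(* Tangency at P means meeting only at P in the extended plane.  In particular
   two lines are tangent iff they are parallel and distinct, with P = None. *)
Definition tangent_at (R : realType) (C D : ocircle R) (P : option R[i]) :
  Prop := locus C `&` locus D = [set P].

Definition descartes_configuration (R : realType) (C : 'I_4 -> ocircle R) :
  Prop :=
  (forall i j : 'I_4, i != j -> exists P, tangent_at (C i) (C j) P) /\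
  (forall (i j k l : 'I_4) (P : option R[i]), i != j -> k != l ->
     tangent_at (C i) (C j) P -> tangent_at (C k) (C l) P ->
     [set i; j]%SET = [set k; l]%SET).

Definition compatible_orientation (R : realType) (C : 'I_4 -> ocircle R) :
  Prop :=
  trivIset setT (fun i => ointerior (C i)) \/
  trivIset setT (fun i => ointerior (oreverse (C i))).

(* Main.v *)
Require Import Defs.
From mathcomp Require Import all_boot all_order all_algebra.
From mathcomp Require Import complex.
From mathcomp Require Import all_classical all_reals.
From mathcomp Require Import interval_inference ring lra.

Set Implicit Arguments.
Unset Strict Implicit.

Import Order.TTheory GRing.Theory Num.Theory.
Local Open Scope complex_scope.
Local Open Scope ring_scope.

(** To an oriented circle attach the Lorentz vector [(b', b, b z)], where the
    co-curvature [b'] is the curvature of the image under inversion in the unit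
    circle; its interior is [b |w|^2 - 2 <b z, w> + b' < 0].  At a common point
    of two circles the Lorentz product of their vectors is the product of the
    unit normals, so it is [-1] as soon as the interiors are disjoint: otherwise
    one enters both interiors along the sum of the normals.  Hence the Gram
    matrix of a Descartes configuration is [2 I - J], with inverse
    [I / 2 - J / 4], and inverting the Gram identity [M Q M^T = 2 I - J] gives
    [M^T (I / 2 - J / 4) M = Q^-1].  In the isotropic coordinates
    [(b z, (b z)^*, b, b')] the top left entry of [Q^-1] vanishes. *)

Definition cocurvature (R : realType) (C : ocircle R) : R :=
  match C with
  | OCircle _ z r => ocurvature C * (dotc z z - r%:num ^+ 2)
  | OLine _ p _ => 2 * p
  end.

Definition circle_eqn (R : realType) (C : ocircle R) (w : R[i]) : R :=
  ocurvature C * dotc w w - 2 * dotc (curvature_center C) w + cocurvature C.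

Definition lorentz (R : realType) (C D : ocircle R) : R :=
  dotc (curvature_center C) (curvature_center D)
  - 2^-1 * (ocurvature C * cocurvature D + cocurvature C * ocurvature D).

(** * Equations, interiors and loci of oriented circles *)

Lemma normc_dotc (R : realType) (w : R[i]) : `|w| = (Num.sqrt (dotc w w))%:C.
Proof. by case: w => x y; rewrite normc_def /dotc /= !expr2. Qed.

Lemma dotc_ge0 (R : realType) (w : R[i]) : 0 <= dotc w w.
Proof. by rewrite /dotc -!expr2 addr_ge0 ?sqr_ge0. Qed.


Lemma posnum_sqrt (R : realType) (r : {posnum R}) :
  r%:num = Num.sqrt (r%:num ^+ 2).
Proof. by rewrite sqrtr_sqr gtr0_norm. Qed.

Lemma normc_lt (R : realType) (w : R[i]) (r : {posnum R}) :
  (`|w| < (r%:num)%:C) = (dotc w w < r%:num ^+ 2).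
Proof. by rewrite normc_dotc ltcR {1}posnum_sqrt ltr_sqrt // exprn_gt0. Qed.

Lemma normc_gt (R : realType) (w : R[i]) (r : {posnum R}) :
  ((r%:num)%:C < `|w|) = (r%:num ^+ 2 < dotc w w).
Proof.
by rewrite normc_dotc ltcR !ltNge {1}posnum_sqrt ler_sqrt // exprn_ge0.
Qed.

Lemma dotc_norm1 (R : realType) (w : R[i]) : `|w| = 1 -> dotc w w = 1.
Proof.
rewrite normc_dotc => /(congr1 (@complex.Re R)) /= w1.
by rewrite -(sqr_sqrtr (dotc_ge0 _)) w1 expr1n.
Qed.

Lemma circle_eqn_circle (R : realType) (o : bool) (z w : R[i]) (r : {posnum R}) :
  circle_eqn (OCircle o z r) w =
  ocurvature (OCircle o z r) * (dotc (w - z) (w - z) - r%:num ^+ 2).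
Proof.
rewrite /circle_eqn /cocurvature /curvature_center.
case: z w (ocurvature _) => [x y] [u v] b; rewrite /dotc /=; ring.
Qed.

Lemma circle_eqn_line (R : realType) (h w : R[i]) (p : R) (h1 : `|h| = 1) :
  circle_eqn (OLine h p h1) w = 2 * (p - dotc h w).
Proof. by rewrite /circle_eqn /=; ring. Qed.

Lemma ointeriorE (R : realType) (C : ocircle R) (w : R[i]) :
  ointerior C w = (circle_eqn C w < 0) :> Prop.
Proof.
case: C => [[] z r | h p h1] /=.
- by rewrite circle_eqn_circle normc_lt pmulr_rlt0 ?invr_gt0 //= subr_lt0.
- rewrite circle_eqn_circle /= normc_gt mulNr oppr_lt0.
  by rewrite pmulr_rgt0 ?invr_gt0 //= subr_gt0.
- by rewrite circle_eqn_line pmulr_rlt0 // subr_lt0.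
Qed.

Lemma circle_eqn_oreverse (R : realType) (C : ocircle R) (w : R[i]) :
  circle_eqn (oreverse C) w = - circle_eqn C w.
Proof.
case: C => [[] z r | h p h1] /=; rewrite ?circle_eqn_circle ?circle_eqn_line /=.
- ring.
- ring.
- by case: h w {h1} => x y [u v]; rewrite /dotc /=; ring.
Qed.

Lemma lorentz_oreverse (R : realType) (C D : ocircle R) :
  lorentz (oreverse C) (oreverse D) = lorentz C D.
Proof.
case: C D => [[] [x y] r | [x y] p h1] [[] [x' y'] r' | [x' y'] p' h1'];
  by rewrite /lorentz /dotc /=; ring.
Qed.

Lemma locus_oreverse (R : realType) (C : ocircle R) :
  locus (oreverse C) = locus C.
Proof.
case: C => [// | h p h1] /=; congr (_ `|` (_ @` _))%classic.
apply/seteqP; split=> -[u v]; case: h {h1} => x y; rewrite /dotc /=; lra.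
Qed.

Lemma locus_circle_eqn (R : realType) (C : ocircle R) (w : R[i]) :
  locus C (Some w) -> circle_eqn C w = 0.
Proof.
case: C => [o z r | h p h1] /=.
  case=> v + [<-]; rewrite circle_eqn_circle /= normc_dotc.
  move=> /(congr1 (@complex.Re R)) /= <-.
  by rewrite sqr_sqrtr ?dotc_ge0 // subrr mulr0.
by case=> // -[v + [<-]]; rewrite circle_eqn_line /= => ->; rewrite subrr mulr0.
Qed.

(** * Unit normals and the Lorentz product *)

Lemma dotc_curvature_center (R : realType) (C : ocircle R) :
  dotc (curvature_center C) (curvature_center C)
  = 1 + ocurvature C * cocurvature C.
Proof.
case: C => [o z r | h p h1] /=; last by rewrite dotc_norm1 // mul0r addr0.
have : (if o then (r%:num)^-1 else - (r%:num)^-1) ^+ 2 * r%:num ^+ 2 = 1.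
  by case: o; rewrite ?sqrrN -exprMn mulVf // expr1n.
case: z => x y; move: (if o then _ else _) => b br; rewrite /dotc /=.
by rewrite -br; ring.
Qed.

(** Half the gradient of [circle_eqn C] at [w]; on the curve it is the unit normal pointing out of
    the interior. *)
Definition normal (R : realType) (C : ocircle R) (w : R[i]) : R[i] :=
  (ocurvature C)%:C * w - curvature_center C.

Lemma dotc_normal (R : realType) (C D : ocircle R) (w : R[i]) :
  circle_eqn C w = 0 -> circle_eqn D w = 0 ->
  dotc (normal C w) (normal D w) = lorentz C D.
Proof.
rewrite /circle_eqn /normal /lorentz.
case: w (curvature_center C) (curvature_center D) => u v [x y] [x' y'].
(* The two sides differ by half of [ocurvature D * circle_eqn C w + ocurvature C * circle_eqn D
   w]. *)
rewrite /dotc /= => eC eD; nra.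
Qed.

Lemma dotc_normal1 (R : realType) (C : ocircle R) (w : R[i]) :
  circle_eqn C w = 0 -> dotc (normal C w) (normal C w) = 1.
Proof.
by move=> eC; rewrite dotc_normal // /lorentz dotc_curvature_center; field.
Qed.

Lemma circle_eqnD (R : realType) (C : ocircle R) (w u : R[i]) (t : R) :
  circle_eqn C (w + t%:C * u) =
  circle_eqn C w + 2 * t * dotc (normal C w) u + t ^+ 2 * ocurvature C * dotc u u.
Proof.
rewrite /circle_eqn /normal; case: w u (curvature_center C) => ? ? [? ?] [? ?].
by rewrite /dotc /=; ring.
Qed.

Lemma sqr_dotcD (R : realType) (u v : R[i]) : dotc u u = 1 -> dotc v v = 1 ->
  dotc (u + v) (u + v) = 2 * (1 + dotc u v).
Proof.
case: u v => [x y] [x' y'] /=; rewrite /dotc /=; nra.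
Qed.

Lemma dotcDr (R : realType) (u v w : R[i]) :
  dotc u (v + w) = dotc u v + dotc u w.
Proof. by case: u v w => ? ? [? ?] [? ?]; rewrite /dotc /=; ring. Qed.

Lemma dotcC (R : realType) (u v : R[i]) : dotc u v = dotc v u.
Proof. by rewrite /dotc mulrC [X in _ + X]mulrC. Qed.

Lemma dotcZr (R : realType) (t : R) (u v : R[i]) :
  dotc u (t%:C * v) = t * dotc u v.
Proof. by case: u v => ? ? [? ?]; rewrite /dotc /=; ring. Qed.

(** * Disjoint interiors and the value -1 *)

Lemma lorentz_disjoint_finite (R : realType) (C D : ocircle R) (w : R[i]) :
  (forall w, ~ (ointerior C w /\ ointerior D w)) ->
  circle_eqn C w = 0 -> circle_eqn D w = 0 -> lorentz C D = -1.
Proof.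
move=> disj eC eD.
have nC := dotc_normal1 eC; have nD := dotc_normal1 eD.
have nCD := dotc_normal eC eD.
have u2 := sqr_dotcD nC nD; rewrite nCD in u2.
have := dotc_ge0 (normal C w + normal D w); rewrite u2 => s0.
have [//|/eqP sN1] := pselect (lorentz C D = -1).
have {sN1}s0 : 0 < 1 + lorentz C D by move/eqP: sN1; lra.
set s := 1 + _ in s0 u2.
(* The step against the outward normals has length factor [k^-1]: [k] exceeds both curvatures, so
   the linear term, which is negative, dominates the quadratic one in both equations. *)
pose k := 1 + `|ocurvature C| + `|ocurvature D|.
have k0 : 0 < k by rewrite /k ltr_wpDr // ltr_wpDr.
have step b : b < k -> 2 * - k^-1 * s + (- k^-1) ^+ 2 * b * (2 * s) < 0.
  move=> bk; have -> : 2 * - k^-1 * s + (- k^-1) ^+ 2 * b * (2 * s)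
      = 2 * s * k^-1 ^+ 2 * (b - k) by field; rewrite gt_eqF.
  rewrite pmulr_rlt0 ?subr_lt0 // !mulr_gt0 // invr_gt0 //.
have bC : ocurvature C < k.
  by have := ler_norm (ocurvature C); have := normr_ge0 (ocurvature D); rewrite /k; lra.
have bD : ocurvature D < k.
  by have := ler_norm (ocurvature D); have := normr_ge0 (ocurvature C); rewrite /k; lra.
case: (disj (w + (- k^-1)%:C * (normal C w + normal D w))).
rewrite !ointeriorE !circle_eqnD eC eD u2 !(dotcDr _ (normal _ _)) nC nD [dotc (normal D w) _]dotcC nCD.
by rewrite [_ + 1]addrC !add0r; split; apply: step.
Qed.

Lemma lorentz_disjoint_lines (R : realType) (h h' : R[i]) (p p' : R)
    (h1 : `|h| = 1) (h1' : `|h'| = 1) :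
  (forall w, ~ (ointerior (OLine h p h1) w /\ ointerior (OLine h' p' h1') w)) ->
  lorentz (OLine h p h1) (OLine h' p' h1') = -1.
Proof.
move=> disj; rewrite /lorentz /= mul0r mulr0 addr0 mulr0 subr0.
have := sqr_dotcD (dotc_norm1 h1) (dotc_norm1 h1').
have := dotc_ge0 (h + h') => + u2; rewrite u2 => s0.
have [//|/eqP sN1] := pselect (dotc h h' = -1).
have {sN1}s0 : 0 < 1 + dotc h h' by move/eqP: sN1; lra.
(* The scaling gives this point the same product [1 + |p| + |p'|] with [h] and with [h'], which
   exceeds both [p] and [p']. *)
case: (disj (((1 + `|p| + `|p'|) / (1 + dotc h h'))%:C * (h + h'))) => /=.
rewrite !dotcZr !dotcDr !dotc_norm1 // [dotc h' h]dotcC [_ + 1]addrC.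
rewrite divfK ?gt_eqF //.
have := ler_norm p; have := ler_norm p'.
by have := normr_ge0 p; have := normr_ge0 p'; split; lra.
Qed.

(** No circle passes through infinity, so a common point [None] leaves only the case of two
    lines. *)
Lemma lorentz_disjoint (R : realType) (C D : ocircle R) (P : option R[i]) :
  (forall w, ~ (ointerior C w /\ ointerior D w)) ->
  locus C P -> locus D P -> lorentz C D = -1.
Proof.
move=> disj; case: P => [w /locus_circle_eqn eC /locus_circle_eqn eD | ].
  exact: lorentz_disjoint_finite eC eD.
case: C D disj => [o z r | h p h1] [o' z' r' | h' p' h1'] disj //=.
- by case.
- by case.
- by move=> _ [].
- by move=> _ _; apply: lorentz_disjoint_lines.
Qed.

Lemma lorentz_compatible (R : realType) (C : 'I_4 -> ocircle R) (i j : 'I_4) :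
  descartes_configuration C -> compatible_orientation C -> i != j ->
  lorentz (C i) (C j) = -1.
Proof.
move=> [tang _] compat ij.
have disj (I : 'I_4 -> set R[i]) : trivIset setT I -> forall w, ~ (I i w /\ I j w).
  move=> tI w IijE; move/eqP: ij; apply.
  by apply: (tI i j Logic.I Logic.I); exists w.
have [P] := tang _ _ ij; rewrite /tangent_at => eP.
have [PC PD] : (locus (C i) `&` locus (C j))%classic P by rewrite eP.
case: compat => [tC | tC]; first exact: lorentz_disjoint (disj _ tC) PC PD.
(* Reversal negates both Lorentz vectors, which leaves their product unchanged, and it preserves the
   loci. *)
rewrite -lorentz_oreverse.
by apply: (lorentz_disjoint (disj _ tC)); rewrite locus_oreverse;
  [exact: PC | exact: PD].
Qed.

Lemma lorentzxx (R : realType) (C : ocircle R) : lorentz C C = 1.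
Proof. by rewrite /lorentz dotc_curvature_center; field. Qed.

(** * The Gram identity and its inversion *)

Definition isotropic_row (R : realType) (C : ocircle R) : seq R[i] :=
  [:: curvature_center C; (curvature_center C)^*;
      (ocurvature C)%:C; (cocurvature C)%:C].

(** The isotropic row times [2 Q]; the factor 2 clears the halves in the Lorentz form. *)
Definition isotropic_dual (R : realType) (C : ocircle R) : seq R[i] :=
  [:: (curvature_center C)^*; curvature_center C;
      - (cocurvature C)%:C; - (ocurvature C)%:C].

Lemma isotropic_lorentz (R : realType) (C D : ocircle R) :
  \sum_(k < 4) (isotropic_row C)`_k * (isotropic_dual D)`_k
  = 2 * (lorentz C D)%:C.
Proof.
rewrite !big_ord_recl big_ord0 /= /bump /= /lorentz.
case: (curvature_center C) (curvature_center D) => x y [x' y'].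
move: (ocurvature C) (ocurvature D) (cocurvature C) (cocurvature D) => a b c d.
rewrite /dotc /=; apply/eqP; rewrite eq_complex /=.
by apply/andP; split; apply/eqP; field.
Qed.

Theorem theorem2p1 (R : realType) (C : 'I_4 -> ocircle R)
  (hC : descartes_configuration C) (hcompat : compatible_orientation C) :
  \sum_(j < 4) curvature_center (C j) ^+ 2
  = 2^-1 * (\sum_(j < 4) curvature_center (C j)) ^+ 2.
Proof.
pose M : 'M[R[i]]_4 := \matrix_(i, k) (isotropic_row (C i))`_k.
pose L : 'M[R[i]]_4 := \matrix_(i, k) (isotropic_dual (C i))`_k.
have gram : M *m L^T = 4%:M - const_mx 2.
  apply/matrixP=> i j; rewrite !mxE.
  under eq_bigr do rewrite !mxE.
  rewrite isotropic_lorentz; have [->|ij] := eqVneq i j.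
    by rewrite lorentzxx rmorph1 mulr1n; ring.
  by rewrite (lorentz_compatible hC hcompat ij) rmorphN1 mulr0n; ring.
(* The inverse of [4 I - 2 J], because [J^2 = 4 J] in dimension 4. *)
pose G : 'M[R[i]]_4 := 4^-1%:M - const_mx 8^-1.
have MK : M *m (L^T *m G) = 1%:M.
  rewrite mulmxA gram mulmxBr mul_mx_scalar mulmxBl mul_scalar_mx.
  apply/matrixP=> i j; rewrite !mxE.
  under eq_bigr do rewrite !mxE.
  by rewrite sumr_const card_ord; case: (i == j); rewrite ?mulr1n ?mulr0n; field.
(* Row 1 of [L^T] and column 0 of [M] both list the [curvature_center (C j)], so this off-diagonal
   entry says that the quadratic form of [G] vanishes on them; 4 times it is the claim. *)
have /matrixP /(_ 1 0) := mulmx1C MK.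
rewrite -mulmxA !(mxE, big_ord_recl, big_ord0) /= ?mulr1n ?mulr0n => NK.
apply/subr0_eq; rewrite -[RHS](mulr0 4) -[in RHS]NK.
by field.
Qed.
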